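(* Let $X=X_1\times\cdots\times X_N\subset\mathbb{R}^n$ with each $X_i\subset\mathbb{R}^{n_i}$ non-empty, compact and convex, let $f(x)=\frac12x^TQx+r^Tx$ with $Q\in\mathbb{R}^{n\times n}$ symmetric, positive definite and strictly block diagonally dominant relative to $p=[n_1,\dots,n_N]^T$, and $r\in\mathbb{R}^n$, and let $\hat{x}=\arg\min_{x\in X}f(x)$. Let the total asynchrony assumption and the nested-sets assumption of the context hold, and let $\gamma_i\in\Big(0,\frac{2}{\sum_{j=1}^N\|Q^{[i]}_j\|_2}\Big)$ for all $i\in[N]$. If $c(k)$ communication cycles have been completed at time $k$ in Algorithm 1, then $$\|x_i(k)-\hat{x}\|_{2,p}\le q^{c(k)}D_o\quad\text{for all }i\in[N],$$ where $q=\max_{i\in[N]}\Big(\|I-\gamma_iQ^{[i]}_i\|_2+\gamma_i\sum_{j\ne i}\|Q^{[i]}_j\|_2\Big)$ and $D_o=\max_{i\in[N]}\|x_i(0)-\hat{x}\|_{2,p}$.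
   Context: Notation: $[N]=\{1,\dots,N\}$, $n_i\ge 1$, $n=\sum_{i=1}^N n_i$. A vector $x\in\mathbb{R}^n$ is partitioned as $x=(x^{[1]},\dots,x^{[N]})$ with $x^{[i]}\in\mathbb{R}^{n_i}$. A matrix $B\in\mathbb{R}^{n\times n}$ is partitioned into blocks $B^{[i]}_j\in\mathbb{R}^{n_i\times n_j}$, and $B^{[i]}=[B^{[i]}_1\ \cdots\ B^{[i]}_N]$ is its $i$-th block row. $\|\cdot\|_2$ is the Euclidean norm or the induced matrix norm, and $\|x\|_{2,p}=\max_{i\in[N]}\|x^{[i]}\|_2$. $B$ is strictly block diagonally dominant relative to $p$ if every $B^{[i]}_i$ is nonsingular and $\big(\|(B^{[i]}_i)^{-1}\|_2\big)^{-1}>\sum_{j\ne i}\|B^{[i]}_j\|_2$ for all $i\in[N]$. $\Pi_{X_i}$ is Euclidean projection onto $X_i$. Algorithm 1: each agent $i\in[N]$ stores a local copy $x_i(k)=(x_i^{[1]}(k),\dots,x_i^{[N]}(k))$ of the full state at times $k=0,1,2,\dots$, with $x_i(0)\in X$. $K^i\subset\mathbb{N}$ is the set of times at which agent $i$ updates its own state. For all $i\in[N]$, $$x_i^{[i]}(k+1)=\Pi_{X_i}\big[x_i^{[i]}(k)-\gamma_i(Q^{[i]}x_i(k)+r^{[i]})\big]\ \text{if }k\in K^i,\qquad x_i^{[i]}(k+1)=x_i^{[i]}(k)\ \text{if }k\notin K^i,$$ and for $j\ne i$, $x_i^{[j]}(k+1)=x_j^{[j]}(\tau^j_i(k+1))$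 if agent $i$ receives agent $j$'s state at time $k+1$, and $x_i^{[j]}(k+1)=x_i^{[j]}(k)$ otherwise. Here $\tau^j_i(k)$ is the time at which the value $x_i^{[j]}(k)$ was originally computed by agent $j$. Total asynchrony assumption: each $K^i$ is infinite, and for all $i$ and $j\ne i$, if $\{k_d\}_{d\in\mathbb{N}}$ is a sequence in $K^i$ tending to infinity then $\lim_{d\to\infty}\tau^j_i(k_d)=\infty$. Nested-sets assumption: there is a collection of sets $\{X(s)\}_{s\in\mathbb{N}}$ such that (1) $\cdots\subset X(s+1)\subset X(s)\subset\cdots\subset X$; (2) $\lim_{s\to\infty}X(s)=\{\hat{x}\}$; (3) for all $i\in[N]$, $s\in\mathbb{N}$ there is $X_i(s)\subset X_i$ such that $X(s)=X_1(s)\times\cdots\times X_N(s)$; (4) $\theta_i(y):=\Pi_{X_i}[y^{[i]}-\gamma_i(Q^{[i]}y+r^{[i]})]\in X_i(s+1)$ for all $y\in X(s)$ and $i\in[N]$. The paper uses the collection $X(s)=\{y\in X:\|y-\hat{x}\|_{2,p}\le q^sD_o\}$. Communication cycle: one communication cycle occurs when every agent has calculated a state update and this updated state has been sent to and received by every other agent. Once the last updated state has been received by the last agent, a communication cycle ends and another begins; $c(k)$ is the number of cycles completed by time $k$.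
   Formalization: It is additionally assumed that each τ^j_i(k) is nondecreasing in k (a received value never replaces a more recently computed one); without this, a stale message arriving after a completed communication cycle can violate the bound. *)

(* Defs.v *)
From mathcomp Require Import all_boot all_order all_algebra.
From mathcomp Require Import all_classical all_reals all_analysis.

Set Implicit Arguments.
Unset Strict Implicit.
Unset Printing Implicit Defensive.

Import Order.TTheory GRing.Theory Num.Theory.
Import numFieldNormedType.Exports.

Local Open Scope classical_set_scope.
Local Open Scope ring_scope.

Section Norms.
Context {R : realType}.

(* The norm `|_| that the library puts on matrices is the max norm, hence
   these two definitions. *)
Definition norm2 {m : nat} (v : 'cV[R]_m) : R :=
  Num.sqrt (\sum_(a < m) v a 0 ^+ 2).

Definition opnorm2 {m l : nat} (A : 'M[R]_(m, l)) : R :=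
  sup [set norm2 (A *m v) | v in [set v : 'cV[R]_l | norm2 v <= 1]].

Definition proj {m : nat} (C : set 'cV[R]_m) (v : 'cV[R]_m) : 'cV[R]_m :=
  get [set u | C u /\ forall w, C w -> norm2 (v - u) <= norm2 (v - w)].

End Norms.

Section Blocks.
Context {R : realType} {N : nat} {p : 'I_N -> nat}.

(* R^n with n = \sum_i p i.  The blocks x^[i], B^[i] and B^[i]_j are
   [submxcol x i], [submxcol B i] and [submxblock B i j]. *)
Notation vec := 'cV[R]_(\sum_i p i).
Notation mat := 'M[R]_(\sum_i p i).

(* The default value 0 of this maximum and of the one in [rate] is harmless:
   all the terms are nonnegative. *)
Definition norm2p (x : vec) : R :=
  \big[Num.max/0]_(i < N) norm2 (submxcol x i).

Definition strictly_block_diag_dominant (B : mat) : Prop :=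
  forall i : 'I_N, submxblock B i i \in unitmx /\
    \sum_(j < N | j != i) opnorm2 (submxblock B i j)
      < (opnorm2 (invmx (submxblock B i i)))^-1.

Definition posdefmx (B : mat) : Prop :=
  forall x : vec, x != 0 -> 0 < (x^T *m B *m x) 0 0.

Definition block_prod (C : forall i : 'I_N, set 'cV[R]_(p i)) : set vec :=
  [set x | forall i, C i (submxcol x i)].

Definition quad (Q : mat) (r x : vec) : R :=
  2^-1 * (x^T *m Q *m x) 0 0 + (r^T *m x) 0 0.

Definition is_argmin (f : vec -> R) (C : set vec) (x : vec) : Prop :=
  C x /\ forall y, C y -> f x <= f y.

Definition theta (X : forall i : 'I_N, set 'cV[R]_(p i)) (Q : mat) (r : vec)
    (gamma : 'I_N -> R) (i : 'I_N) (y : vec) : 'cV[R]_(p i) :=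
  proj (X i)
    (submxcol y i - gamma i *: (submxcol Q i *m y + submxcol r i)).

Definition rate (Q : mat) (gamma : 'I_N -> R) : R :=
  \big[Num.max/0]_(i < N)
    (opnorm2 (1%:M - gamma i *: submxblock Q i i)
     + gamma i * \sum_(j < N | j != i) opnorm2 (submxblock Q i j)).

(* The set-theoretic limit: the limits inferior and superior coincide. *)
Definition set_lim {T : Type} (F : (set T)^nat) (L : set T) : Prop :=
  \bigcup_n \bigcap_(j >= n) F j = L /\ \bigcap_n \bigcup_(j >= n) F j = L.

Definition nested_sets (X : forall i : 'I_N, set 'cV[R]_(p i)) (Q : mat)
    (r : vec) (gamma : 'I_N -> R) (xhat : vec) (Xs : (set vec)^nat) : Prop :=
  [/\ forall s, Xs s.+1 `<=` Xs s /\ Xs s `<=` block_prod X,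
      set_lim Xs [set xhat] &
      exists Xis : nat -> forall i : 'I_N, set 'cV[R]_(p i),
        [/\ forall s i, Xis s i `<=` X i,
            forall s, Xs s = block_prod (Xis s) &
            forall s y i, Xs s y -> Xis s.+1 i (theta X Q r gamma i y)]].

(* [x k i] is the copy of the whole state that agent i stores at time k,
   [K i] the set of times at which agent i updates its own state,
   [recv i j k] means that agent i receives agent j's state at time k, and
   [tau i j k] is the time at which the j-th block of [x k i] was computed by
   agent j.  The values [recv i i] and [tau i i] are never used. *)
Definition algorithm1 (X : forall i : 'I_N, set 'cV[R]_(p i)) (Q : mat)
    (r : vec) (gamma : 'I_N -> R) (K : 'I_N -> set nat)
    (recv : 'I_N -> 'I_N -> set nat) (tau : 'I_N -> 'I_N -> nat -> nat)
    (x : nat -> 'I_N -> vec) : Prop :=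
  [/\ forall i, block_prod X (x 0%N i),
      forall i k, K i k ->
        submxcol (x k.+1 i) i = theta X Q r gamma i (x k i),
      forall i k, ~ K i k ->
        submxcol (x k.+1 i) i = submxcol (x k i) i,
      forall i j k, j != i -> recv i j k.+1 ->
        submxcol (x k.+1 i) j = submxcol (x (tau i j k.+1) j) j &
      forall i j k, j != i -> ~ recv i j k.+1 ->
        submxcol (x k.+1 i) j = submxcol (x k i) j].

End Blocks.

Section Communication.
Context {N : nat}.
Implicit Types (K : 'I_N -> set nat) (recv : 'I_N -> 'I_N -> set nat)
  (tau : 'I_N -> 'I_N -> nat -> nat).

(* What it means for [tau i j k] to be the time at which the value that agent
   i holds at time k was computed: it is not later than k; it does not change
   as long as nothing is received; and it is either 0 (initial values) or the
   first time t.+1 at which the result of an update of agent j performed at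
   step t is available.  In particular tau i j 0 = 0. *)
Definition computation_times K recv tau : Prop :=
  forall i j : 'I_N, j != i ->
    [/\ forall k, (tau i j k <= k)%N,
        forall k, ~ recv i j k.+1 -> tau i j k.+1 = tau i j k &
        forall k, tau i j k = 0%N \/ exists2 t, K j t & tau i j k = t.+1].

(* Messages of one agent to another take effect in the order in which their
   contents were computed: a value is never overwritten by an older one.
   Otherwise a message computed before the end of a communication cycle could
   arrive long after it and undo the effect of that cycle. *)
Definition in_order tau : Prop :=
  forall i j : 'I_N, j != i -> forall k, (tau i j k <= tau i j k.+1)%N.

Definition total_asynchrony K tau : Prop :=
  (forall i, infinite_set (K i)) /\
  forall i j : 'I_N, j != i -> forall kd : nat -> nat,
    (forall d, K i (kd d)) -> kd @ \oo --> \oo ->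
    (fun d => tau i j (kd d)) @ \oo --> \oo.

(* A cycle that began at time s is complete at time t: every agent j has
   performed, at some step k of the cycle, an update whose result (which
   carries the time k.+1) has been received by every other agent. *)
Definition cycle_complete K recv tau (s t : nat) : Prop :=
  forall j : 'I_N, exists k,
    [/\ K j k, (s <= k < t)%N &
        forall i : 'I_N, i != j -> exists m,
          [/\ (m <= t)%N, recv i j m & tau i j m = k.+1]].

(* The number of cycles completed by time k, and the time at which the cycle
   in progress at time k began. *)
Fixpoint cycle_state K recv tau (k : nat) : nat * nat :=
  if k is k'.+1 then
    let: (c, s) := cycle_state K recv tau k' in
    if `[< cycle_complete K recv tau s k >] then (c.+1, k) else (c, s)
  else (0%N, 0%N).

Definition cycles K recv tau (k : nat) : nat := (cycle_state K recv tau k).1.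

End Communication.

(* Main.v *)
(* One update of agent i contracts: the projection is nonexpansive, xhat^[i]
   is a fixed point of theta_i (the variational inequality of the constrained
   minimizer, restricted to block i), and the gradient step has Lipschitz
   constant at most q from norm2p to norm2.  Moreover q <= 1: for the symmetric
   block A = Q^[i]_i, v^T A v lies between |v|^2 / |A^-1| and |A| |v|^2, so
   block diagonal dominance and the bound on gamma_i give
   |I - gamma_i A| <= 1 - gamma_i * \sum_(j != i) |Q^[i]_j|.
   Hence all errors stay below Do.  If from time s on every copy has error at
   most b, an update of agent j made after s has error at most q b, and so have
   all later values of agent j's own block.  When the cycle ends every other
   agent holds such a value, and by the ordering of the messages never
   an older one again, so each cycle improves b to q b. *)

Require Import Defs.
From mathcomp Require Import all_boot all_order all_algebra.
From mathcomp Require Import all_classical all_reals all_analysis.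
From mathcomp Require Import ring lra.
Import Order.TTheory GRing.Theory Num.Theory.
Import numFieldNormedType.Exports.
Local Open Scope classical_set_scope.
Local Open Scope ring_scope.

Set Implicit Arguments.
Unset Strict Implicit.
Unset Printing Implicit Defensive.

(** * Euclidean inner product, norm and the Cauchy-Schwarz inequality *)

Section InnerProduct.
Context {R : realType}.

Definition dotv {m : nat} (u v : 'cV[R]_m) : R := (u^T *m v) 0 0.

Lemma dotvE m (u v : 'cV[R]_m) : dotv u v = \sum_a u a 0 * v a 0.
Proof. by rewrite /dotv mxE; apply: eq_bigr => a _; rewrite mxE. Qed.

Lemma dotvC m (u v : 'cV[R]_m) : dotv u v = dotv v u.
Proof. by rewrite !dotvE; apply: eq_bigr => a _; rewrite mulrC. Qed.

Lemma dotvDr m (u v w : 'cV[R]_m) : dotv u (v + w) = dotv u v + dotv u w.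
Proof. by rewrite /dotv mulmxDr mxE. Qed.

Lemma dotvZr m (u v : 'cV[R]_m) c : dotv u (c *: v) = c * dotv u v.
Proof. by rewrite /dotv -scalemxAr mxE. Qed.

Lemma dotvNr m (u v : 'cV[R]_m) : dotv u (- v) = - dotv u v.
Proof. by rewrite /dotv mulmxN mxE. Qed.

Lemma dotvDl m (u v w : 'cV[R]_m) : dotv (v + w) u = dotv v u + dotv w u.
Proof. by rewrite !(dotvC _ u) dotvDr. Qed.

Lemma dotvZl m (u v : 'cV[R]_m) c : dotv (c *: v) u = c * dotv v u.
Proof. by rewrite !(dotvC _ u) dotvZr. Qed.

Lemma dotvNl m (u v : 'cV[R]_m) : dotv (- v) u = - dotv v u.
Proof. by rewrite !(dotvC _ u) dotvNr. Qed.

Lemma dotv_mul m (A : 'M[R]_m) u v : dotv (A *m u) v = dotv u (A^T *m v).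
Proof. by rewrite /dotv trmx_mul mulmxA. Qed.

Definition dotvS := (dotvDr, dotvDl, dotvZr, dotvZl, dotvNr, dotvNl).

Lemma dotvv_ge0 m (v : 'cV[R]_m) : 0 <= dotv v v.
Proof. by rewrite dotvE sumr_ge0// => a _; rewrite -expr2 sqr_ge0. Qed.

Lemma norm2_ge0 m (v : 'cV[R]_m) : 0 <= norm2 v.
Proof. exact: sqrtr_ge0. Qed.

Lemma norm2_sqr m (v : 'cV[R]_m) : norm2 v ^+ 2 = dotv v v.
Proof.
have -> : norm2 v = Num.sqrt (dotv v v).
  by rewrite /norm2 dotvE; congr Num.sqrt; apply: eq_bigr => a _; rewrite expr2.
by rewrite sqr_sqrtr ?dotvv_ge0.
Qed.

Lemma norm2Z m c (v : 'cV[R]_m) : norm2 (c *: v) = `|c| * norm2 v.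
Proof.
apply/eqP; rewrite -(@eqrXn2 _ 2)// ?norm2_ge0 ?mulr_ge0 ?norm2_ge0//.
by rewrite exprMn !norm2_sqr real_normK ?num_real// !dotvS mulrA -expr2.
Qed.

Lemma norm2N m (v : 'cV[R]_m) : norm2 (- v) = norm2 v.
Proof. by rewrite -scaleN1r norm2Z normrN1 mul1r. Qed.

Lemma norm2_eq0 m (v : 'cV[R]_m) : norm2 v = 0 -> v = 0.
Proof.
move=> v0; have := norm2_sqr v; rewrite v0 expr0n/= dotvE => /esym/eqP.
rewrite psumr_eq0; last by move=> a _; rewrite -expr2 sqr_ge0.
move=> /allP h; apply/matrixP => a b; rewrite ord1 mxE.
by have := h a (mem_index_enum _); rewrite -expr2 sqrf_eq0 => /eqP.
Qed.

Lemma norm2_0 m : norm2 (0 : 'cV[R]_m) = 0.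
Proof. by rewrite -(scale0r 0) norm2Z normr0 mul0r. Qed.

(** For [c > 0] the minimizer [t = - b / c] gives the inequality. For [c = 0] the function is affine
    and forces [b = 0]: otherwise its value at the [t] chosen below is -1. *)
Lemma nonneg_quadratic_discr (a b c : R) : 0 <= c ->
  (forall t, 0 <= a + t * b *+ 2 + t ^+ 2 * c) -> b ^+ 2 <= a * c.
Proof.
rewrite le_eqVlt => /predU1P[<-|c0] h.
  have [->|b0] := eqVneq b 0; first by rewrite expr0n mulr0.
  have := h (- (a + 1) / (2 * b)).
  have -> : - (a + 1) / (2 * b) * b *+ 2 = - (a + 1).
    by rewrite -mulr_natr; field; rewrite b0.
  lra.
have := h (- b / c).
have -> : a + - b / c * b *+ 2 + (- b / c) ^+ 2 * c = a - b ^+ 2 / c.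
  by field; rewrite lt0r_neq0.
by rewrite subr_ge0 ler_pdivrMr.
Qed.

(** First-order condition at a minimum, as [t] tends to 0. The proof takes [t = - a / B] with [B]
    above [b] and at least [- a], so that [t <= 1] and the quadratic is negative there. *)
Lemma nonneg_of_small_quadratic (a b : R) :
  (forall t, 0 < t -> t <= 1 -> 0 <= t * a + t ^+ 2 * b) -> 0 <= a.
Proof.
move=> h; rewrite leNgt; apply/negP => a0.
pose B := `|b| + `|a| + 1.
have B0 : 0 < B by rewrite /B ltr_wpDl// addr_ge0.
have bB : b < B by rewrite /B; have := ler_norm b; have := normr_ge0 a; lra.
have aB : - a <= B by rewrite /B (ltr0_norm a0); have := normr_ge0 b; lra.
have := h (- a / B); rewrite divr_gt0 ?oppr_gt0// ler_pdivrMr// mul1r aB.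
move=> /(_ isT isT); apply/negP; rewrite -ltNge.
rewrite (_ : _ + _ = - (a ^+ 2 * (B - b) / B ^+ 2)); last first.
  by field; rewrite gt_eqF.
rewrite oppr_lt0 divr_gt0 ?exprn_gt0// mulr_gt0 ?subr_gt0//.
by rewrite exprn_even_gt0//= lt_eqF.
Qed.

(** The form of [A] at [u + t *: v] is a nonnegative quadratic in [t]. *)
Lemma psd_CauchySchwarz m (A : 'M[R]_m) (u v : 'cV[R]_m) : A^T = A ->
  (forall w, 0 <= dotv w (A *m w)) ->
  dotv u (A *m v) ^+ 2 <= dotv u (A *m u) * dotv v (A *m v).
Proof.
move=> symA psdA; apply: nonneg_quadratic_discr => // t.
have -> : dotv u (A *m u) + t * dotv u (A *m v) *+ 2 + t ^+ 2 * dotv v (A *m v)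
  = dotv (u + t *: v) (A *m (u + t *: v)).
  rewrite mulmxDr -scalemxAr !dotvS.
  rewrite (_ : dotv v (A *m u) = dotv u (A *m v)); first by ring.
  by rewrite dotvC dotv_mul symA.
exact: psdA.
Qed.

Lemma CauchySchwarz m (u v : 'cV[R]_m) : dotv u v <= norm2 u * norm2 v.
Proof.
have [d0|d0] := ltP (dotv u v) 0.
  by rewrite (le_trans (ltW d0)) ?mulr_ge0 ?norm2_ge0.
rewrite -(@ler_pXn2r _ 2)// ?nnegrE ?mulr_ge0 ?norm2_ge0//.
rewrite exprMn !norm2_sqr.
have := @psd_CauchySchwarz m 1%:M u v.
by rewrite !mul1mx trmx1; apply=> // w; rewrite mul1mx dotvv_ge0.
Qed.

Lemma norm2D m (u v : 'cV[R]_m) : norm2 (u + v) <= norm2 u + norm2 v.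
Proof.
rewrite -(@ler_pXn2r _ 2)// ?nnegrE ?addr_ge0 ?norm2_ge0//.
rewrite sqrrD !norm2_sqr !dotvS (dotvC v u).
have := CauchySchwarz u v; lra.
Qed.

Lemma norm2_sum m (I : Type) (s : seq I) (P : pred I) (F : I -> 'cV[R]_m) :
  norm2 (\sum_(i <- s | P i) F i) <= \sum_(i <- s | P i) norm2 (F i).
Proof.
elim/big_rec2 : _ => [|i b a _ ab]; first by rewrite norm2_0.
by rewrite (le_trans (norm2D _ _)) ?lerD2l.
Qed.

Lemma continuous_dist2 m (v : 'cV[R]_m) :
  continuous (fun u : 'cV[R]_m => norm2 (v - u)).
Proof.
have cf : continuous (fun u : 'cV[R]_m => \sum_(a < m) (v - u) a 0 ^+ 2).
  apply: continuous_big => [|a _ u]; first exact: add_continuous.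
  rewrite (_ : (fun w => _) =
    (fun w : 'cV[R]_m => (v a 0 - w a 0) * (v a 0 - w a 0))).
    have h : {for u, continuous (fun w : 'cV[R]_m => v a 0 - w a 0)}.
      by apply: continuousB; [exact: cst_continuous|exact: coord_continuous].
    exact: (continuousM h h).
  by apply/funext => w; rewrite !mxE expr2.
by move=> u; apply: (continuous_comp (cf u)); exact: sqrt_continuous.
Qed.

End InnerProduct.

(** * Induced matrix norm and quadratic forms of symmetric matrices *)

Section OperatorNorm.
Context {R : realType}.

(** Makes the supremum in [opnorm2] meaningful: [A *m v] combines the columns of [A] with
    coefficients of absolute value at most 1. *)
Lemma opnorm2_has_ubound m l (A : 'M[R]_(m, l)) :
  has_ubound [set norm2 (A *m v) | v in [set v : 'cV[R]_l | norm2 v <= 1]].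
Proof.
pose s := \sum_j norm2 (col j A).
exists s => _ [v /= v1 <-].
have -> : A *m v = \sum_j v j 0 *: col j A.
  apply/matrixP => a b; rewrite !mxE summxE; apply: eq_bigr => j _.
  by rewrite !mxE mulrC ord1.
apply: (le_trans (norm2_sum _ _ _)); apply: ler_sum => j _.
rewrite norm2Z ler_piMl ?norm2_ge0//; apply: le_trans v1.
rewrite -(@ler_pXn2r _ 2)// ?nnegrE ?norm2_ge0//.
rewrite real_normK ?num_real// norm2_sqr dotvE (bigD1 j)//= -expr2 lerDl.
by rewrite sumr_ge0// => k _; rewrite -expr2 sqr_ge0.
Qed.

Lemma opnorm2_ge0 m l (A : 'M[R]_(m, l)) : 0 <= opnorm2 A.
Proof.
apply: ub_le_sup; first exact: opnorm2_has_ubound.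
by exists 0; rewrite /= ?norm2_0// mulmx0 norm2_0.
Qed.

Lemma norm2_mulmx m l (A : 'M[R]_(m, l)) v :
  norm2 (A *m v) <= opnorm2 A * norm2 v.
Proof.
have [v0|v0] := eqVneq (norm2 v) 0.
  by rewrite (norm2_eq0 v0) mulmx0 !norm2_0 mulr0.
have v_gt0 : 0 < norm2 v by rewrite lt_neqAle eq_sym v0 norm2_ge0.
have : norm2 (A *m ((norm2 v)^-1 *: v)) <= opnorm2 A.
  apply: ub_le_sup; first exact: opnorm2_has_ubound.
  exists ((norm2 v)^-1 *: v) => //=.
  by rewrite norm2Z ger0_norm ?invr_ge0 ?norm2_ge0// mulVf.
rewrite -scalemxAr norm2Z ger0_norm ?invr_ge0 ?norm2_ge0//.
by rewrite ler_pdivrMl// mulrC.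
Qed.

Lemma opnorm2_le m l (A : 'M[R]_(m, l)) mu : 0 <= mu ->
  (forall v, norm2 (A *m v) <= mu * norm2 v) -> opnorm2 A <= mu.
Proof.
move=> mu0 h; apply: ge_sup.
  by exists (norm2 (A *m 0)); exists 0; rewrite //= norm2_0.
move=> _ [v /= v1 <-]; apply: (le_trans (h v)).
by rewrite ler_piMr.
Qed.

(* Polarization: 4 <M v, w> = <M (v + w), v + w> - <M (v - w), v - w> with w
   the multiple of M v of the same norm as v. *)
Lemma sym_opnorm2_le m (M : 'M[R]_m) mu : 0 <= mu -> M^T = M ->
  (forall v, `|dotv v (M *m v)| <= mu * dotv v v) -> opnorm2 M <= mu.
Proof.
move=> mu0 symM h; apply: opnorm2_le => // v.
have [Mv0|Mv0] := eqVneq (norm2 (M *m v)) 0.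
  by rewrite Mv0 mulr_ge0 ?norm2_ge0.
have Mv_gt0 : 0 < norm2 (M *m v) by rewrite lt_neqAle eq_sym Mv0 norm2_ge0.
have [v0|v0] := eqVneq (norm2 v) 0.
  by rewrite (norm2_eq0 v0) mulmx0 !norm2_0 mulr0.
have v_gt0 : 0 < norm2 v by rewrite lt_neqAle eq_sym v0 norm2_ge0.
pose w := (norm2 v / norm2 (M *m v)) *: (M *m v).
have wvw : dotv w w = dotv v v.
  rewrite -!norm2_sqr norm2Z ger0_norm ?divr_ge0 ?norm2_ge0//.
  by rewrite divfK.
have wMv : dotv w (M *m v) = norm2 v * norm2 (M *m v).
  by rewrite dotvZl -norm2_sqr; field.
have vMw : dotv v (M *m w) = dotv w (M *m v) by rewrite dotvC dotv_mul symM.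
move: w wvw wMv vMw => {}w wvw wMv vMw.
(* Adding the two bounds cancels the forms at [v] and at [w] as well as the products [dotv v w]. *)
have /ler_normlP[_ h1] := h (v + w).
have /ler_normlP[h2 _] := h (v - w).
move: h1 h2; rewrite !mulmxDr !mulmxN !dotvS vMw wMv wvw (dotvC w v) => h1 h2.
have : norm2 v * norm2 (M *m v) <= mu * dotv v v by lra.
by rewrite -norm2_sqr expr2 mulrCA ler_pM2l.
Qed.

(* Cauchy-Schwarz for the form of A applied to v and A^-1 v. *)
Lemma posdef_form_ge m (A : 'M[R]_m) v : A^T = A -> A \in unitmx ->
  (forall w, 0 <= dotv w (A *m w)) ->
  dotv v v <= opnorm2 (invmx A) * dotv v (A *m v).
Proof.
move=> symA unitA psdA.
have [v0|v0] := eqVneq (norm2 v) 0.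
  by rewrite -norm2_sqr v0 expr0n/= mulr_ge0 ?opnorm2_ge0.
have v_gt0 : 0 < dotv v v.
  by rewrite -norm2_sqr exprn_gt0// lt_neqAle eq_sym v0 norm2_ge0.
have := @psd_CauchySchwarz _ _ A v (invmx A *m v) symA psdA.
rewrite mulmxA mulmxV// mul1mx (dotvC _ v) => h.
have h1 : dotv v (invmx A *m v) <= opnorm2 (invmx A) * dotv v v.
  apply: (le_trans (CauchySchwarz _ _)).
  rewrite -norm2_sqr expr2 mulrCA ler_wpM2l ?norm2_ge0//.
  exact: norm2_mulmx.
have : dotv v v ^+ 2 <= dotv v (A *m v) * (opnorm2 (invmx A) * dotv v v).
  by apply: (le_trans h); rewrite ler_wpM2l.
by rewrite expr2 mulrA ler_pM2r// mulrC.
Qed.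

(** The form of [A] lies between [S] and [opnorm2 A] times the squared norm, so that of
    [1%:M - g *: A] lies between [1 - g * opnorm2 A] and [1 - g * S] times it. The upper bound on
    [g] makes the former at least [- (1 - g * S)]. *)
Lemma opnorm2_gradient_step m (A : 'M[R]_m) g S : (0 < m)%N -> A^T = A ->
  A \in unitmx -> (forall w, 0 <= dotv w (A *m w)) ->
  0 <= S -> S < (opnorm2 (invmx A))^-1 -> 0 < g -> g * (opnorm2 A + S) <= 2 ->
  opnorm2 (1%:M - g *: A) <= 1 - g * S.
Proof.
move=> m0 symA unitA psdA S0 Slt g0 gle.
have inv_gt0 : 0 < opnorm2 (invmx A) by rewrite -invr_gt0 (le_lt_trans S0).
have low v : S * dotv v v <= dotv v (A *m v).
  have := posdef_form_ge v symA unitA psdA.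
  rewrite mulrC -ler_pdivrMr// mulrC => /(le_trans _); apply.
  by rewrite ler_wpM2r ?dotvv_ge0// ltW.
have up v : dotv v (A *m v) <= opnorm2 A * dotv v v.
  apply: (le_trans (CauchySchwarz _ _)).
  rewrite -norm2_sqr expr2 mulrCA ler_wpM2l ?norm2_ge0//.
  exact: norm2_mulmx.
have key v : `|dotv v ((1%:M - g *: A) *m v)| <= (1 - g * S) * dotv v v.
  rewrite mulmxBl mul1mx -scalemxAl !dotvS.
  have h1 : g * (S * dotv v v) <= g * dotv v (A *m v) by rewrite ler_pM2l.
  have h2 : g * dotv v (A *m v) <= g * (opnorm2 A * dotv v v).
    by rewrite ler_pM2l.
  have h3 : g * (opnorm2 A + S) * dotv v v <= 2 * dotv v v.
    by rewrite ler_wpM2r// dotvv_ge0.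
  by rewrite ler_norml; apply/andP; split; lra.
apply: sym_opnorm2_le => //; last by rewrite linearB linearZ/= symA trmx1.
(* As [0 < m], the all-ones vector is nonzero, and [key] at it yields [0 <= 1 - g * S]. *)
pose e : 'cV[R]_m := const_mx 1.
have e0 : 0 < dotv e e.
  rewrite dotvE (eq_bigr (fun=> 1)); last by move=> a _; rewrite !mxE mulr1.
  by rewrite sumr_const card_ord ltr0n.
by rewrite -(pmulr_lge0 _ e0); apply: le_trans (key e).
Qed.

End OperatorNorm.

(** * Euclidean projection onto compact convex sets *)

(* [proj] alone denotes a coordinate projection of mathcomp-analysis. *)
Section Projection.
Context {R : realType} {m : nat}.
Implicit Types (C : set 'cV[R]_m) (u v w : 'cV[R]_m).

Lemma convex_set_segment C u w (t : R) : convex_set C -> C u -> C w ->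
  0 <= t -> t <= 1 -> C (u + t *: (w - u)).
Proof.
move=> cC Cu Cw t0 t1.
have /set_mem h := cC w u (Itv01 t0 t1) (mem_set Cw) (mem_set Cu).
rewrite (_ : u + _ = t *: w + (1 - t) *: u)//.
by rewrite scalerBl scale1r scalerBr addrCA.
Qed.

Lemma projP C v : C !=set0 -> compact C ->
  C (Defs.proj C v) /\
  forall w, C w -> norm2 (v - Defs.proj C v) <= norm2 (v - w).
Proof.
move=> C0 cC.
have [|u uC umin] := compact_EVT_min (f := fun u => norm2 (v - u)) C0 cC.
  exact/continuous_subspaceT/continuous_dist2.
apply: (@getPex _
  [set u | C u /\ forall w, C w -> norm2 (v - u) <= norm2 (v - w)]).
exists u; split; first exact: set_mem.
by move=> w Cw; apply: umin; exact: mem_set.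
Qed.

(** Moving from the projection towards [w] cannot decrease the distance to [v]; the first-order term
    of the squared distance gives the inequality. *)
Lemma proj_obtuse C v w : C !=set0 -> compact C -> convex_set C -> C w ->
  dotv (v - Defs.proj C v) (w - Defs.proj C v) <= 0.
Proof.
move=> C0 cC cvC Cw; have [Cu umin] := projP v C0 cC.
set u := Defs.proj C v in Cu umin *.
rewrite -oppr_ge0.
apply: (@nonneg_of_small_quadratic _ _ (dotv (w - u) (w - u) / 2)).
move=> t t0 t1.
have := umin _ (convex_set_segment cvC Cu Cw (ltW t0) t1).
rewrite -(@ler_pXn2r _ 2)// ?nnegrE ?norm2_ge0// !norm2_sqr.
rewrite opprD addrA; move: (v - u) (w - u) => y d.
rewrite !dotvS (dotvC d y); lra.
Qed.

Lemma proj_dist_le C v a v' : C !=set0 -> compact C -> convex_set C -> C a ->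
  (forall w, C w -> dotv (v' - a) (w - a) <= 0) ->
  norm2 (Defs.proj C v - a) <= norm2 (v - v').
Proof.
move=> C0 cC cvC Ca ha; have [Cu _] := projP v C0 cC.
have h1 := proj_obtuse v C0 cC cvC Ca; have := ha _ Cu.
set u := Defs.proj C v in Cu h1 *; move=> h2.
have [->|ua0] := eqVneq (norm2 (u - a)) 0; first exact: norm2_ge0.
have ua_gt0 : 0 < norm2 (u - a) by rewrite lt_neqAle eq_sym ua0 norm2_ge0.
rewrite -(ler_pM2r ua_gt0) -expr2 norm2_sqr.
apply: le_trans (CauchySchwarz _ _).
move: h1 h2; rewrite !dotvS (dotvC a u); lra.
Qed.

End Projection.

(** * Block structure, blockwise optimality and contraction of the update *)

Section Blocks.
Context {R : realType} {N : nat} {p : 'I_N -> nat}.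
Notation vec := 'cV[R]_(\sum_i p i).
Notation mat := 'M[R]_(\sum_i p i).

Lemma dotv_blocks (u v : vec) :
  dotv u v = \sum_i dotv (submxcol u i) (submxcol v i).
Proof.
rewrite {1}/dotv -(submxcolK u) -(submxcolK v) tr_mxcol mul_mxrow_mxcol summxE.
by apply: eq_bigr => i _; rewrite !mxcolK.
Qed.

Lemma submxcol_mulmx (Q : mat) (v : vec) i :
  submxcol Q i *m v = \sum_j submxblock Q i j *m submxcol v j.
Proof.
rewrite -{1}(submxcolK v) -(submxrowK (submxcol Q i)) mul_mxrow_mxcol.
by apply: eq_bigr => j _; rewrite submxblockEv.
Qed.

(** [dfwith] overrides the zero family at [i]; it is dependent because the type of a block varies
    with its index. *)
Definition embed i (d : 'cV[R]_(p i)) : vec :=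
  \mxcol_j eqtype.dfwith (fun j => 0 : 'cV[R]_(p j)) d j.

Lemma submxcol_embed i (d : 'cV[R]_(p i)) : submxcol (embed d) i = d.
Proof. by rewrite mxcolK dfwith_in. Qed.

Lemma submxcol_embed0 i j (d : 'cV[R]_(p i)) : j != i ->
  submxcol (embed d) j = 0.
Proof. by move=> ji; rewrite mxcolK dfwith_out// eq_sym. Qed.

Lemma dotv_embed i (u : vec) (d : 'cV[R]_(p i)) :
  dotv u (embed d) = dotv (submxcol u i) d.
Proof.
rewrite dotv_blocks (bigD1 i)//= submxcol_embed big1 ?addr0// => j ji.
by rewrite submxcol_embed0// /dotv mulmx0 mxE.
Qed.

(** Passes positivity from [Q] to its diagonal blocks. *)
Lemma submxblock_diag_form (Q : mat) i (d : 'cV[R]_(p i)) :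
  dotv d (submxblock Q i i *m d) = dotv (embed d) (Q *m embed d).
Proof.
rewrite [RHS]dotvC dotv_embed -submxcol_mul submxcol_mulmx dotvC.
congr dotv; rewrite (bigD1 i)//= submxcol_embed big1 ?addr0// => j ji.
by rewrite submxcol_embed0// mulmx0.
Qed.

Lemma quadE (Q : mat) r x : quad Q r x = 2^-1 * dotv x (Q *m x) + dotv r x.
Proof. by rewrite /quad /dotv mulmxA. Qed.

(** Moving [xhat] towards [w] in block [i] alone stays in the product set, so the first-order
    condition holds blockwise. *)
Lemma argmin_block_obtuse (X : forall i, set 'cV[R]_(p i)) (Q : mat)
    (r xhat : vec) i w :
  (forall i, convex_set (X i)) -> Q^T = Q ->
  is_argmin (quad Q r) (block_prod X) xhat -> X i w ->
  0 <= dotv (submxcol Q i *m xhat + submxcol r i) (w - submxcol xhat i).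
Proof.
move=> cX symQ [Xhat hmin] Xw; set d := w - _.
rewrite submxcol_mul -submxcolD -dotv_embed.
apply: (@nonneg_of_small_quadratic _ _
  (2^-1 * dotv (embed d) (Q *m embed d))) => t t0 t1.
have /hmin : block_prod X (xhat + t *: embed d).
  move=> j; rewrite submxcolD.
  have -> : submxcol (t *: embed d) j = t *: submxcol (embed d) j.
    by apply/matrixP => a b; rewrite !mxE.
  have [->|ji] := eqVneq j i.
    by rewrite submxcol_embed; apply: convex_set_segment => //; exact: ltW.
  by rewrite submxcol_embed0// scaler0 addr0.
rewrite -subr_ge0 !quadE; congr (0 <= _).
rewrite mulmxDr -scalemxAr !dotvS.
rewrite (_ : dotv xhat (Q *m embed d) = dotv (Q *m xhat) (embed d)).
  by rewrite (dotvC (embed d) (Q *m xhat)); field.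
by rewrite dotv_mul symQ.
Qed.

Lemma le_norm2p (x : vec) i : norm2 (submxcol x i) <= norm2p x.
Proof. exact: (le_bigmax _ (fun i => norm2 (submxcol x i))). Qed.

Lemma rate_ge0 (Q : mat) gamma : 0 <= rate Q gamma.
Proof. exact: bigmax_ge_id. Qed.

(** Keeps errors from growing between cycles. Dominance and the step size bound are what
    [opnorm2_gradient_step] asks of the off-diagonal sum [S]. *)
Lemma rate_le1 (Q : mat) gamma : (forall i, (0 < p i)%N) -> Q^T = Q ->
  posdefmx Q -> strictly_block_diag_dominant Q ->
  (forall i, 0 < gamma i
    /\ gamma i < 2 / \sum_(j < N) opnorm2 (submxblock Q i j)) ->
  rate Q gamma <= 1.
Proof.
move=> p0 symQ posQ domQ hgamma; apply: bigmax_le => // i _.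
have [unitQ Slt] := domQ i; have [g0 glt] := hgamma i.
set S := \sum_(j < N | j != i) _ in Slt *.
have S0 : 0 <= S by apply: sumr_ge0 => j _; exact: opnorm2_ge0.
rewrite -lerBrDr; apply: opnorm2_gradient_step => //.
- by rewrite tr_submxblock symQ.
- move=> w; rewrite submxblock_diag_form.
  have [->|w0] := eqVneq (embed w) 0; first by rewrite /dotv mulmx0 mulmx0 mxE.
  by rewrite /dotv mulmxA ltW// posQ.
- move: glt; rewrite (bigD1 i)//= -/S.
  have : 0 <= opnorm2 (submxblock Q i i) + S by rewrite addr_ge0 ?opnorm2_ge0.
  rewrite le_eqVlt => /predU1P[<-|T0]; first by rewrite mulr0.
  by rewrite ltr_pdivlMr// => /ltW.
Qed.

Lemma theta_contraction (X : forall i, set 'cV[R]_(p i)) (Q : mat)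
    (r xhat : vec) gamma i y b :
  (forall i, X i !=set0) -> (forall i, compact (X i)) ->
  (forall i, convex_set (X i)) -> Q^T = Q ->
  is_argmin (quad Q r) (block_prod X) xhat -> 0 <= gamma i ->
  (forall j, norm2 (submxcol (y - xhat) j) <= b) ->
  norm2 (theta X Q r gamma i y - submxcol xhat i) <= rate Q gamma * b.
Proof.
move=> X0 kX cX symQ hxhat g0 hb.
have b0 : 0 <= b by apply: le_trans (hb i); exact: norm2_ge0.
(* [v'] is the gradient step at [xhat]; optimality gives [submxcol xhat i] the variational
   inequality of the projection of [v']. *)
pose v' := submxcol xhat i - gamma i *: (submxcol Q i *m xhat + submxcol r i).
apply: (@le_trans _ _ (norm2 (submxcol y i
    - gamma i *: (submxcol Q i *m y + submxcol r i) - v'))).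
  apply: proj_dist_le => //; first by have [+ _] := hxhat; exact.
  move=> w Xw; rewrite /v' addrAC subrr add0r dotvNl dotvZl oppr_le0.
  by rewrite mulr_ge0//; apply: argmin_block_obtuse hxhat Xw.
(* The difference of the gradient steps is linear in [y - xhat]: [r] cancels, and the diagonal block
   is split off. *)
have -> : submxcol y i - gamma i *: (submxcol Q i *m y + submxcol r i) - v'
  = (1%:M - gamma i *: submxblock Q i i) *m submxcol (y - xhat) i
    - gamma i *: \sum_(j | j != i) submxblock Q i j *m submxcol (y - xhat) j.
  rewrite mulmxBl mul1mx -scalemxAl -[RHS]addrA -opprD -scalerDr.
  rewrite -(bigD1 i (P := predT)
    (F := fun j => submxblock Q i j *m submxcol (y - xhat) j))//=.
  rewrite -submxcol_mulmx mulmxBr submxcolB /v'.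
  by apply/matrixP => a c; rewrite !mxE; ring.
apply: (le_trans (norm2D _ _)).
rewrite norm2N norm2Z ger0_norm//.
apply: (@le_trans _ _ ((opnorm2 (1%:M - gamma i *: submxblock Q i i)
     + gamma i * \sum_(j < N | j != i) opnorm2 (submxblock Q i j)) * b)).
  rewrite mulrDl -mulrA; apply: lerD.
    by apply: (le_trans (norm2_mulmx _ _)); rewrite ler_wpM2l ?opnorm2_ge0.
  rewrite ler_wpM2l// mulr_suml; apply: (le_trans (norm2_sum _ _ _)).
  apply: ler_sum => j _.
  by apply: (le_trans (norm2_mulmx _ _)); rewrite ler_wpM2l ?opnorm2_ge0.
rewrite ler_wpM2r//.
exact: (le_bigmax _ (fun i => opnorm2 (1%:M - gamma i *: submxblock Q i i)
     + gamma i * \sum_(j < N | j != i) opnorm2 (submxblock Q i j))).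
Qed.

End Blocks.

(** * Propagation of errors through asynchronous communication *)

Section CommunicationCycles.
Context {R : realType} {N : nat}.
Context (K : 'I_N -> set nat) (recv : 'I_N -> 'I_N -> set nat)
  (tau : 'I_N -> 'I_N -> nat -> nat).
(* [e k i j] is the error at time k of the copy of block j held by agent i. *)
Context (e : nat -> 'I_N -> 'I_N -> R) (q D : R).
Context (htau : computation_times K recv tau) (horder : in_order tau)
  (q0 : 0 <= q) (q1 : q <= 1) (D0 : 0 <= D)
  (e_init : forall i j, e 0 i j <= D)
  (e_update : forall i k b, K i k -> (forall j, e k i j <= b) ->
    e k.+1 i i <= q * b)
  (e_idle : forall i k, ~ K i k -> e k.+1 i i = e k i i)
  (e_recv : forall i j k, j != i -> recv i j k.+1 ->
    e k.+1 i j = e (tau i j k.+1) j j)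
  (e_keep : forall i j k, j != i -> ~ recv i j k.+1 -> e k.+1 i j = e k i j).

(* Fails for a block never received: the agents may start from different
   initial copies, and then tau i j k = 0. *)
Lemma copy_error i j k : j != i -> (0 < tau i j k)%N ->
  e k i j = e (tau i j k) j j.
Proof.
move=> ji; have [tau_le tau_keep _] := htau ji; elim: k => [|k IH] tau0.
  by have := tau_le 0%N; rewrite leqNgt tau0.
have [rk|rk] := pselect (recv i j k.+1); first exact: e_recv.
by rewrite e_keep// tau_keep// IH// -tau_keep.
Qed.

(** Strong induction on time, because a received block may have been computed at any earlier
    time. *)
Lemma initial_error_bound k i j : e k i j <= D.
Proof.
suff h m : (m <= k)%N -> forall i j, e m i j <= D by exact: h.
elim: m {-2}m (leqnn m) => [|n IH] m; first by rewrite leqn0 => /eqP->.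
rewrite leq_eqVlt => /predU1P[->|]; last by rewrite ltnS => /IH.
move=> nk.
(* Own blocks come first: a block received at [n.+1] may have been computed at that very time. *)
have own j' : e n.+1 j' j' <= D.
  have en j'' : e n j' j'' <= D by apply: IH => //; exact: ltnW.
  have [Kj|Kj] := pselect (K j' n); last by rewrite e_idle.
  by rewrite (le_trans (e_update Kj en))// ler_piMl.
move=> i' j'; have [->//|ji] := eqVneq j' i'.
have [rk|rk] := pselect (recv i' j' n.+1); last first.
  by rewrite e_keep//; apply: IH => //; exact: ltnW.
rewrite e_recv//; have [tau_le _ _] := htau ji.
have := tau_le n.+1; rewrite leq_eqVlt => /predU1P[->//|].
by rewrite ltnS => tn; apply: IH => //; exact: leq_trans tn (ltnW nk).
Qed.

(** After step [k], idle steps keep the value and further updates contract again from copies within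
    [b]. *)
Lemma own_error_after_update b s j k m :
  (forall t, (s <= t)%N -> forall i, e t j i <= b) ->
  K j k -> (s <= k)%N -> (k < m)%N -> e m j j <= q * b.
Proof.
move=> hb Kk sk; elim: m => // m IH; rewrite ltnS leq_eqVlt => /predU1P[<-|km].
  by apply: e_update => // i; exact: hb.
have [Km|Km] := pselect (K j m); last by rewrite e_idle// IH.
by apply: e_update => // i; apply: hb; exact: leq_trans sk (ltnW km).
Qed.

Lemma in_order_le i j k m : j != i -> (k <= m)%N -> (tau i j k <= tau i j m)%N.
Proof.
move=> ji; elim: m => [|m IH]; first by rewrite leqn0 => /eqP->.
rewrite leq_eqVlt => /predU1P[->//|]; rewrite ltnS => /IH/leq_trans; apply.
exact: horder.
Qed.

Lemma cycle_complete_error b s t : cycle_complete K recv tau s t ->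
  (forall m, (s <= m)%N -> forall i j, e m i j <= b) ->
  forall m, (t <= m)%N -> forall i j, e m i j <= q * b.
Proof.
move=> hc hb m tm i j; have [k [Kk /andP[sk kt] hrecv]] := hc j.
have own n : (k < n)%N -> e n j j <= q * b.
  exact: own_error_after_update (fun t st i => hb t st j i) Kk sk.
have [->|ij] := eqVneq i j; first exact: own (leq_trans kt tm).
have [n [nt _ taun]] := hrecv i ij; rewrite eq_sym in ij.
(* The copy held at time [m] is no older than the one received in the cycle. Its time stamp is thus
   positive, as [copy_error] requires, and exceeds [k], as [own] requires. *)
have ktau : (k < tau i j m)%N.
  by rewrite -taun; apply: in_order_le => //; exact: leq_trans nt tm.
by rewrite copy_error ?own//; exact: leq_ltn_trans ktau.
Qed.

Lemma cycle_start_le k : ((cycle_state K recv tau k).2 <= k)%N.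
Proof.
elim: k => //= k; case: cycle_state => c s /= sk.
by case: ifP => //= _; exact: leqW.
Qed.

(** The induction covers all times from the start of the current cycle on, since
    [cycle_complete_error] needs the bound throughout. *)
Lemma error_after_cycles k i j : e k i j <= q ^+ cycles K recv tau k * D.
Proof.
suff h : forall t, ((cycle_state K recv tau k).2 <= t)%N -> forall i j,
    e t i j <= q ^+ (cycle_state K recv tau k).1 * D.
  exact: h (cycle_start_le k) i j.
elim: k => [t _ i' j'|k].
  by rewrite expr0 mul1r initial_error_bound.
rewrite /=; case: cycle_state => c s /= IH.
case: ifPn => [/asboolP hc|//] /=.
by rewrite exprS -mulrA; exact: cycle_complete_error hc IH.
Qed.

End CommunicationCycles.

(** * Convergence rate of the asynchronous algorithm *)

Theorem theorem3 (R : realType) (N : nat) (p : 'I_N -> nat)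
  (hp : forall i, (0 < p i)%N)
  (X : forall i : 'I_N, set 'cV[R]_(p i))
  (hX0 : forall i, X i !=set0)
  (hXcompact : forall i, compact (X i))
  (hXconvex : forall i, convex_set (X i))
  (Q : 'M[R]_(\sum_i p i)) (r : 'cV[R]_(\sum_i p i))
  (hQsym : Q^T = Q)
  (hQpos : posdefmx Q)
  (hQdom : strictly_block_diag_dominant Q)
  (xhat : 'cV[R]_(\sum_i p i))
  (hxhat : is_argmin (quad Q r) (block_prod X) xhat)
  (gamma : 'I_N -> R)
  (hgamma : forall i, 0 < gamma i
    /\ gamma i < 2 / \sum_(j < N) opnorm2 (submxblock Q i j))
  (hnested : exists Xs : (set 'cV[R]_(\sum_i p i))^nat,
    nested_sets X Q r gamma xhat Xs)
  (K : 'I_N -> set nat) (recv : 'I_N -> 'I_N -> set nat)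
  (tau : 'I_N -> 'I_N -> nat -> nat)
  (x : nat -> 'I_N -> 'cV[R]_(\sum_i p i))
  (htau : computation_times K recv tau)
  (horder : in_order tau)
  (hasync : total_asynchrony K tau)
  (hx : algorithm1 X Q r gamma K recv tau x)
  (q Do : R)
  (hq : q = rate Q gamma)
  (hDo : Do = \big[Num.max/0]_(i < N) norm2p (x 0%N i - xhat)) :
  forall (k : nat) (i : 'I_N),
    norm2p (x k i - xhat) <= q ^+ cycles K recv tau k * Do.
Proof.
move=> k i; have [_ x_update x_idle x_recv x_keep] := hx.
have Do0 : 0 <= Do by rewrite hDo; exact: bigmax_ge_id.
have q0 : 0 <= q by rewrite hq rate_ge0.
have q1 : q <= 1 by rewrite hq rate_le1.
(* The maximum is bounded block by block; the first goal concerns its default value 0. *)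
apply: bigmax_le => [|j _]; first by rewrite mulr_ge0 ?exprn_ge0.
apply: (error_after_cycles (recv := recv)
  (e := fun k i j => norm2 (submxcol (x k i - xhat) j))) => //.
- move=> i' j'; rewrite hDo; apply: (le_trans (le_norm2p _ _)).
  exact: (le_bigmax _ (fun i => norm2p (x 0%N i - xhat))).
- move=> i' k' b Kk hb; rewrite submxcolB x_update// hq.
  by apply: theta_contraction => //; have [/ltW] := hgamma i'.
- by move=> i' k' Kk; rewrite !submxcolB x_idle.
- by move=> i' j' k' ji rk; rewrite !submxcolB x_recv.
- by move=> i' j' k' ji rk; rewrite !submxcolB x_keep.
Qed.
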